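(* Let $1\le p\le\infty$. There exist functions $\sigma_p,\sigma_p^*:\mathbb{R}\to[0,\infty)$ such that $\sigma_p(t)$ and $\sigma_p^*(t)$ depend only on the sign of $t$ (and on $p$), and such that for all $\pi\in\mathbb{H}_2$ $$K_{2,p}(\pi)=\sigma_p(\det\pi)\sqrt{|\det\pi|},$$ and for all $\pi\in\mathbb{H}_3$ $$K_{3,p}(\pi)=\sigma_p^*(\mathrm{disc}\,\pi)\sqrt[4]{|\mathrm{disc}\,\pi|}.$$
   Context: For an integer $m\ge2$, $\mathbb{H}_m$ denotes the space of real homogeneous polynomials of degree $m$ in $(x,y)$ (including $0$) and $\mathbb{P}_{m-1}$ the space of real polynomials in $(x,y)$ of total degree at most $m-1$. For a nondegenerate closed triangle $T\subset\mathbb{R}^2$ of area $|T|$, $I_{m,T}:C^0(T)\to\mathbb{P}_{m-1}$ is the Lagrange interpolation operator: $I_{m,T}v(\gamma)=v(\gamma)$ for all $\gamma\in T$ whose barycentric coordinates all belong to $\{0,\frac1{m-1},\dots,1\}$. Set $e_{m,T}(v)_p:=\|v-I_{m,T}v\|_{L^p(T)}$ and $K_{m,p}(\pi):=\inf_{|T|=1}e_{m,T}(\pi)_p$ for $\pi\in\mathbb{H}_m$ (infimum over all triangles of area $1$). Determinant on $\mathbb{H}_2$: $\det(ax^2+2bxy+cy^2)=ac-b^2$. Discriminant on $\mathbb{H}_3$: $\mathrm{disc}(ax^3+bx^2y+cxy^2+dy^3)=b^2c^2-4ac^3-4b^3d+18abcd-27a^2d^2$. *)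

(* Defs.v *)
From HB Require Import structures.
From mathcomp Require Import all_boot all_order all_algebra.
From mathcomp Require Import all_classical all_reals all_analysis.
(* The notations of [mpoly] clash with those of MathComp-Analysis. *)
From mathcomp Require Import (canonicals, coercions) mpoly.

Set Implicit Arguments.
Unset Strict Implicit.
Unset Printing Implicit Defensive.

Import Order.TTheory GRing.Theory Num.Theory.
Import numFieldNormedType.Exports.

Local Open Scope classical_set_scope.
Local Open Scope ring_scope.

Notation poly2 R := (mpoly.mpoly 2 R).

(* The variables of index 0 and 1 stand for x and y. *)
Definition eval2 (R : realType) (q : poly2 R) (z : R * R) : R :=
  mpoly.meval (fun i : 'I_2 => if i == ord0 then z.1 else z.2) q.

Definition coef2 (R : realType) (i j : nat) (q : poly2 R) : R :=
  mpoly.mcoeff (mpoly.Multinom [tuple i; j]) q.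

(* [0 \in Hdeg m] for every [m]. *)
Definition Hdeg (R : realType) (m : nat) : {pred poly2 R} :=
  [pred q : poly2 R | q \is mpoly.ishomog1 m mpoly.mdeg].

(* Total degree at most m - 1: [msize q] is one more than the total degree
   of [q], and [msize 0 = 0]. *)
Definition Pdeg (R : realType) (m : nat) : {pred poly2 R} :=
  [pred q : poly2 R | (mpoly.msize q <= m)%N].

Record triangle (R : realType) := Triangle {
  vertex :> 'I_3 -> R * R;
  _ : let A := vertex (inord 0) in
      let B := vertex (inord 1) in
      let C := vertex (inord 2) in
      (B.1 - A.1) * (C.2 - A.2) - (B.2 - A.2) * (C.1 - A.1) != 0
}.

(* [l] is the family of barycentric coordinates of [z] with respect to [T]. *)
Definition barycentric (R : realType) (T : triangle R)
    (l : 'I_3 -> R) (z : R * R) : Prop :=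
  \sum_(i < 3) l i = 1 /\
  z = (\sum_(i < 3) l i * (T i).1, \sum_(i < 3) l i * (T i).2).

Definition tset (R : realType) (T : triangle R) : set (R * R) :=
  [set z | exists l : 'I_3 -> R, barycentric T l z /\ forall i, 0 <= l i].

Definition nodes (R : realType) (m : nat) (T : triangle R) : set (R * R) :=
  [set z | exists l : 'I_3 -> R, barycentric T l z /\
     forall i, exists2 k : nat, (k <= m.-1)%N & l i = k%:R / m.-1%:R].

Definition leb2 (R : realType) :
    {measure set (measurableTypeR R * measurableTypeR R) -> \bar R} :=
  (@lebesgue_measure R \x @lebesgue_measure R)%E.

Definition area (R : realType) (T : triangle R) : \bar R := leb2 R (tset T).

(* For [2 <= m] exactly one element of [Pdeg m] takes prescribed values at
   the nodes, and [xget] returns it. *)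
Definition interp (R : realType) (m : nat) (T : triangle R)
    (v : R * R -> R) : poly2 R :=
  xget 0 [set q : poly2 R |
            q \in Pdeg m /\ forall z, nodes m T z -> eval2 q z = v z].

(* The L^p norm over [T] is the L^p norm over the plane of the function
   extended by 0 outside of [T]. *)
Definition interp_error (R : realType) (m : nat) (p : \bar R)
    (T : triangle R) (v : R * R -> R) : \bar R :=
  Lnorm (leb2 R) p
    (EFin \o ((fun z => v z - eval2 (interp m T v) z) \_ (tset T))).

Definition shapeK (R : realType) (m : nat) (p : \bar R) (q : poly2 R) : \bar R :=
  ereal_inf [set interp_error m p T (eval2 q) |
             T in [set T : triangle R | area T = 1%E]].

(* The quadratic form is a x^2 + 2 b x y + c y^2, hence the halving. *)
Definition det2 (R : realType) (q : poly2 R) : R :=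
  let a := coef2 2 0 q in
  let b := coef2 1 1 q / 2 in
  let c := coef2 0 2 q in
  a * c - b ^+ 2.

Definition disc3 (R : realType) (q : poly2 R) : R :=
  let a := coef2 3 0 q in
  let b := coef2 2 1 q in
  let c := coef2 1 2 q in
  let d := coef2 0 3 q in
  b ^+ 2 * c ^+ 2 - 4 * a * c ^+ 3 - 4 * b ^+ 3 * d
  + 18 * a * b * c * d - 27 * a ^+ 2 * d ^+ 2.

(* Main.v *)
Require Import Defs.
From HB Require Import structures.
From mathcomp Require Import all_boot all_order all_algebra.
From mathcomp Require Import all_classical all_reals all_analysis.
From mathcomp Require Import (canonicals, coercions) mpoly.
From mathcomp Require Import measurable_realfun ess_sup_inf.
From mathcomp Require Import ring lra zify.

Set Implicit Arguments.
Unset Strict Implicit.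
Unset Printing Implicit Defensive.

Import Order.TTheory GRing.Theory Num.Theory.
Import numFieldNormedType.Exports.

Local Open Scope classical_set_scope.
Local Open Scope ring_scope.

(** For an invertible linear map phi of determinant 1, Lebesgue measure is
    phi-invariant (SL_2 is generated by shears, which are handled by Fubini and
    translation invariance on the line) and Lagrange interpolation commutes with
    phi, so K(pi o phi) = K(pi); moreover K(k pi) = |k| K(pi).  Up to these two
    operations every form is either x^2 + y^2 or x^2 - y^2 (degree 2),
    x (x^2 + y^2) or x (x^2 - y^2) (degree 3), or, when the invariant vanishes,
    a form which diag(2, 1/2) multiplies by a constant of absolute value not 1,
    and for which K is therefore 0.  Since det (resp. disc) is SL_2-invariant and
    homogeneous of degree 2 (resp. 4), it determines the scaling factor. *)

(** * Invariance of planar Lebesgue measure and of L^p norms *)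

(** The push-forward under a translation gives each half-open interval its length, and these values
    characterise Lebesgue measure. *)
Lemma lebesgue_measure_translation {R : realType} (t : R)
    (A : set (measurableTypeR R)) : measurable A ->
  lebesgue_measure ((fun x : measurableTypeR R => x + t : measurableTypeR R) @^-1` A)
  = lebesgue_measure A.
Proof.
move=> mA; set f := fun x : measurableTypeR R => x + t : measurableTypeR R.
have mf : measurable_fun setT f by exact: measurable_funD.
apply/esym; rewrite -/(pushforward _ f A).
apply: lebesgue_measure_unique => // _ [[a b]] _ <-; rewrite /= /pushforward.
rewrite (_ : f @^-1` _ = `]a - t, b - t]%classic); last first.
  by apply/seteqP; split=> x /=; rewrite !in_itv /= ltrBlDr lerBrDr.
rewrite !lebesgue_measure_itv /= !lte_fin ltrD2r.
by case: ifP => // _; rewrite -!EFinB; congr (_%:E); ring.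
Qed.

Definition lin {R : realType} (a b c d : R) (z : R * R) : R * R :=
  (a * z.1 + b * z.2, c * z.1 + d * z.2).

Lemma measurable_lin {R : realType} (a b c d : R) :
  measurable_fun setT (lin a b c d : measurableTypeR R * measurableTypeR R ->
                                       measurableTypeR R * measurableTypeR R).
Proof.
by apply: measurable_fun_pair; apply: measurable_funD => //;
  exact: measurable_funM.
Qed.

(** A vertical shear translates each vertical section, and [leb2] integrates the lengths of these
    sections. *)
Lemma leb2_shear2 {R : realType} (t : R) A : measurable A ->
  leb2 R (lin 1 0 t 1 @^-1` A) = leb2 R A.
Proof.
move=> mA; apply: eq_integral => x _ /=.
have -> : xsection (lin 1 0 t 1 @^-1` A) x =
    (fun y : measurableTypeR R => y + t * x : measurableTypeR R) @^-1` xsection A x.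
  by apply/seteqP; split=> y;
    rewrite /xsection /= !inE /lin /= !mul1r mul0r addr0 addrC.
rewrite lebesgue_measure_translation //; exact: measurable_xsection.
Qed.

(** Uniqueness of the product measure allows sections along the other axis, as horizontal shears
    require. *)
Lemma leb2E {R : realType} A : measurable A ->
  leb2 R A = (@lebesgue_measure R \x^ @lebesgue_measure R)%E A.
Proof.
move=> mA; apply: product_measure_unique => // *.
by rewrite /= product_measure2E.
Qed.

Lemma measurable_preimage_lin {R : realType} (a b c d : R)
    (A : set (measurableTypeR R * measurableTypeR R)) :
  measurable A -> measurable (lin a b c d @^-1` A).
Proof. by move=> mA; rewrite -[X in measurable X]setTI; exact: measurable_lin. Qed.

Lemma leb2_shear1 {R : realType} (t : R) A : measurable A ->
  leb2 R (lin 1 t 0 1 @^-1` A) = leb2 R A.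
Proof.
move=> mA; rewrite !leb2E //; last exact: measurable_preimage_lin.
apply: eq_integral => y _ /=.
have -> : ysection (lin 1 t 0 1 @^-1` A) y =
    (fun x : measurableTypeR R => x + t * y : measurableTypeR R) @^-1` ysection A y.
  by apply/seteqP; split=> x;
    rewrite /ysection /= !inE /lin /= !mul1r mul0r add0r.
rewrite lebesgue_measure_translation //; exact: measurable_ysection.
Qed.

Lemma lin_comp {R : realType} (a b c d a' b' c' d' : R) :
  lin a b c d \o lin a' b' c' d' =
  lin (a * a' + b * c') (a * b' + b * d') (c * a' + d * c') (c * b' + d * d').
Proof. by apply/funext => z; rewrite /lin /=; congr pair; ring. Qed.

(* If c != 0 the matrix is a product of three shears; composing with one more
   shear reduces the other case to this one. *)
Lemma leb2_lin {R : realType} (a b c d : R) A :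
  a * d - b * c = 1 -> measurable A -> leb2 R (lin a b c d @^-1` A) = leb2 R A.
Proof.
have c_neq0 a' b' c' d' B : c' != 0 -> a' * d' - b' * c' = 1 -> measurable B ->
    leb2 R (lin a' b' c' d' @^-1` B) = leb2 R B.
  move=> c0 e mB.
  have -> : lin a' b' c' d' =
      lin 1 ((a' - 1) / c') 0 1 \o
      (lin 1 0 c' 1 \o lin 1 ((d' - 1) / c') 0 1).
    rewrite !lin_comp; congr (lin _ _ _ _); try by field.
    have -> : b' = (a' * d' - 1) / c' by rewrite -e; field.
    by field.
  have mlin := @measurable_preimage_lin R.
  rewrite !comp_preimage leb2_shear1; last by do 2 apply: (mlin).
  by rewrite leb2_shear2 ?leb2_shear1 //; exact: mlin.
move=> e mA; have [c0|] := eqVneq c 0; last by move/c_neq0; exact.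
have a0 : a != 0 by apply: contra_eq_neq e => ->; rewrite c0; lra.
have -> : lin a b c d = lin 1 0 (-1) 1 \o lin a b a (b + d).
  by rewrite lin_comp c0; congr lin; ring.
rewrite comp_preimage c_neq0 ?leb2_shear2 //; last exact: measurable_preimage_lin.
by rewrite -e c0; ring.
Qed.

Lemma Lnorm_pushforward d (T : measurableType d) {R : realType}
    (mu : {measure set T -> \bar R}) (phi : T -> T) (p : \bar R) (f : T -> \bar R) :
  (forall A, measurable A -> mu (phi @^-1` A) = mu A) ->
  measurable_fun setT phi -> measurable_fun setT f -> (0 <= p)%E ->
  Lnorm mu p (f \o phi) = Lnorm mu p f.
Proof.
move=> phimu mphi mf; rewrite unlock; case: p => [r|_|//]; last first.
  (* The essential supremum depends only on which superlevel sets are null, and pulling these back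
     along [phi] keeps their measure. *)
  case: ifP => // _; rewrite !ess_supEmu0; last 2 first.
  - exact: measurableT_comp.
  - by apply: measurableT_comp => //; exact: measurableT_comp.
  congr ereal_inf; apply/seteqP; split => y /=;
    rewrite (comp_preimage _ phi (abse \o f)) phimu//;
    rewrite -[X in measurable X]setTI;
    by apply: measurableT_comp => //; exact: emeasurable_itv.
move=> _; congr (_ `^ _)%E.
have mfr : measurable_fun setT (fun x => `|f x| `^ r)%E.
  apply: (@measurableT_comp _ _ _ _ _ _ (fun x : \bar R => x `^ r)%E) => //.
    exact: measurable_poweR.
  exact: measurableT_comp.
transitivity (\int[pushforward mu phi]_x (`|f x| `^ r))%E; last first.
  by apply: eq_measure_integral => A mA _; rewrite /= /pushforward phimu.
rewrite ge0_integral_pushforward ?preimage_setT // => y _; exact: poweR_ge0.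
Qed.

(** * Evaluation, degree and coefficients of polynomials in two variables *)

Lemma eval2E {R : realType} (q : poly2 R) (z : R * R) :
  eval2 q z = \sum_(m <- mpoly.msupp q)
     mpoly.mcoeff m q * (z.1 ^+ m ord0 * z.2 ^+ m ord_max).
Proof.
rewrite /eval2 mpoly.mevalE; apply: eq_bigr => m _.
by rewrite big_ord_recl big_ord1 /=; congr (_ * (_ * _ ^+ m _)); apply: val_inj.
Qed.

Lemma eval2_seq {R : realType} (q : poly2 R) (z : R * R) (s : seq (mpoly.multinom 2)) :
  uniq s -> {subset mpoly.msupp q <= s} ->
  eval2 q z = \sum_(m <- s) mpoly.mcoeff m q * (z.1 ^+ m ord0 * z.2 ^+ m ord_max).
Proof.
move=> us qs; rewrite eval2E [RHS](bigID (mem (mpoly.msupp q)) predT) /=.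
rewrite [X in _ = _ + X]big1 ?addr0 => [|m /mpoly.memN_msupp_eq0 ->]; last by rewrite mul0r.
rewrite -[RHS]big_filter; apply: perm_big; apply: uniq_perm.
- by exact: mpoly.msupp_uniq.
- by exact: filter_uniq.
- by move=> m; rewrite mem_filter /=; case: (boolP (m \in mpoly.msupp q)) => //= /qs ->.
Qed.

Lemma eval2Z {R : realType} (c : R) (q : poly2 R) (z : R * R) :
  eval2 (c *: q) z = c * eval2 q z.
Proof. exact: mpoly.mevalZ. Qed.

Lemma eval2_sum {R : realType} (I : Type) (r : seq I) (F : I -> poly2 R) (z : R * R) :
  eval2 (\sum_(i <- r) F i) z = \sum_(i <- r) eval2 (F i) z.
Proof. exact: raddf_sum. Qed.

Lemma PdegZ {R : realType} (m : nat) (c : R) (q : poly2 R) :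
  q \in Pdeg m -> c *: q \in Pdeg m.
Proof. by rewrite !inE; apply: leq_trans; exact: mpoly.msizeZ_le. Qed.

Lemma mdeg2 (m : mpoly.multinom 2) : mpoly.mdeg m = (m ord0 + m ord_max)%N.
Proof.
by rewrite mpoly.mdegE big_ord_recl big_ord1; congr (_ + m _)%N; apply: val_inj.
Qed.

Lemma dhomog_Pdeg {R : realType} (d : nat) (q : poly2 R) :
  q \in Hdeg d -> q \in Pdeg d.+1.
Proof.
move=> /mpoly.dhomogP qd; rewrite inE mpoly.msizeE; apply/bigmax_leqP_seq => m mq _.
by rewrite qd.
Qed.

(** Both components of the map are linear forms, so substituting them turns a monomial of degree k
    into a homogeneous polynomial of degree k. *)
Lemma Pdeg_lin {R : realType} (m : nat) (a b c d : R) (q : poly2 R) :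
  q \in Pdeg m ->
  exists2 q' : poly2 R, q' \in Pdeg m & forall z, eval2 q' z = eval2 q (lin a b c d z).
Proof.
move=> qm.
pose X i : poly2 R := mpoly.mpolyX R (mpoly.mnm1 i).
pose u := a *: X ord0 + b *: X ord_max; pose v := c *: X ord0 + d *: X ord_max.
have hX i : X i \is mpoly.ishomog1 1 mpoly.mdeg.
  by rewrite mpoly.dhomogX; apply/eqP; exact: mpoly.mdeg1.
have hu : u \is mpoly.ishomog1 1 mpoly.mdeg.
  by apply: mpoly.dhomogD; apply: mpoly.dhomogZ; exact: hX.
have hv : v \is mpoly.ishomog1 1 mpoly.mdeg.
  by apply: mpoly.dhomogD; apply: mpoly.dhomogZ; exact: hX.
have eX z i : eval2 (X i) z = if i == ord0 then z.1 else z.2 by exact: mpoly.mevalXU.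
have eu z : eval2 u z = (lin a b c d z).1.
  by rewrite /eval2 mpoly.mevalD !mpoly.mevalZ -!/(eval2 _ _) !eX.
have ev z : eval2 v z = (lin a b c d z).2.
  by rewrite /eval2 mpoly.mevalD !mpoly.mevalZ -!/(eval2 _ _) !eX.
exists (\sum_(k <- mpoly.msupp q) mpoly.mcoeff k q *: (u ^+ k ord0 * v ^+ k ord_max)).
  rewrite inE; apply: leq_trans (mpoly.msize_sum _ _ _) _.
  apply/bigmax_leqP_seq => k kq _; apply: leq_trans (mpoly.msizeZ_le _ _) _.
  have : u ^+ k ord0 * v ^+ k ord_max \in Hdeg (mpoly.mdeg k).
    have -> : mpoly.mdeg k = (1 * k ord0 + 1 * k ord_max)%N by rewrite mdeg2 !mul1n.
    by apply: mpoly.dhomogM; exact: mpoly.dhomogMn.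
  move/dhomog_Pdeg; rewrite inE => /leq_trans; apply.
  by apply: leq_trans qm; exact: mpoly.msize_mdeg_lt.
move=> z; rewrite [RHS]eval2E eval2_sum; apply: eq_bigr => k _.
rewrite eval2Z; congr (_ * _).
by rewrite /eval2 mpoly.mevalM !rmorphXn /= -!/(eval2 _ _) eu ev.
Qed.

(** Listing the possible exponents in advance turns a degree condition into an explicit formula in
    the coefficients. *)
Lemma eval2_coef {R : realType} (q : poly2 R) (s : seq (nat * nat)) (z : R * R) :
  uniq s -> (forall k, k \in mpoly.msupp q -> (k ord0, k ord_max) \in s) ->
  eval2 q z = \sum_(p <- s) coef2 p.1 p.2 q * (z.1 ^+ p.1 * z.2 ^+ p.2).
Proof.
move=> us qs; pose f (p : nat * nat) := mpoly.Multinom [tuple p.1; p.2].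
have fK (k : mpoly.multinom 2) : f (k ord0, k ord_max) = k.
  apply/mpoly.mnmP => i; rewrite mpoly.multinomE.
  by case: i => [[|[|//]] hi]; rewrite (tnth_nth 0%N) /=;
    congr (mpoly.fun_of_multinom _ _); apply: val_inj.
rewrite (@eval2_seq R q z (map f s)); first last.
- by move=> k /qs ks; rewrite -[k]fK map_f.
- by rewrite map_inj_uniq // => -[a b] [c d] [-> ->].
rewrite big_map; apply: eq_bigr => p _.
by rewrite !mpoly.multinomE !(tnth_nth 0%N).
Qed.

Lemma Pdeg2E {R : realType} (q : poly2 R) (z : R * R) : q \in Pdeg 2 ->
  eval2 q z = coef2 0 0 q + coef2 1 0 q * z.1 + coef2 0 1 q * z.2.
Proof.
rewrite inE => q2.
rewrite (@eval2_coef R q [:: (0, 0); (1, 0); (0, 1)]%N) //; last first.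
  move=> k /mpoly.msize_mdeg_lt/leq_trans => /(_ _ q2); rewrite mdeg2.
  by case: (k ord0) => [|[|]] //; case: (k ord_max) => [|[|]].
by rewrite !big_cons big_nil /=; ring.
Qed.

Lemma Pdeg3E {R : realType} (q : poly2 R) (z : R * R) : q \in Pdeg 3 ->
  eval2 q z = coef2 0 0 q + coef2 1 0 q * z.1 + coef2 0 1 q * z.2
    + coef2 2 0 q * z.1 ^+ 2 + coef2 1 1 q * (z.1 * z.2) + coef2 0 2 q * z.2 ^+ 2.
Proof.
rewrite inE => q3.
rewrite (@eval2_coef R q [:: (0, 0); (1, 0); (0, 1); (2, 0); (1, 1); (0, 2)]%N) //;
    last first.
  move=> k /mpoly.msize_mdeg_lt/leq_trans => /(_ _ q3); rewrite mdeg2.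
  by case: (k ord0) => [|[|[|]]] //; case: (k ord_max) => [|[|[|]]].
by rewrite !big_cons big_nil /=; ring.
Qed.

Lemma Hdeg2E {R : realType} (q : poly2 R) (z : R * R) : q \in Hdeg 2 ->
  eval2 q z = coef2 2 0 q * z.1 ^+ 2 + coef2 1 1 q * (z.1 * z.2) + coef2 0 2 q * z.2 ^+ 2.
Proof.
move=> /mpoly.dhomogP q2.
rewrite (@eval2_coef R q [:: (2, 0); (1, 1); (0, 2)]%N) //; last first.
  move=> k /q2 /=; rewrite mdeg2.
  by case: (k ord0) => [|[|[|?]]] //; case: (k ord_max) => [|[|[|?]]].
by rewrite !big_cons big_nil /=; ring.
Qed.

Lemma Hdeg3E {R : realType} (q : poly2 R) (z : R * R) : q \in Hdeg 3 ->
  eval2 q z = coef2 3 0 q * z.1 ^+ 3 + coef2 2 1 q * (z.1 ^+ 2 * z.2)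
    + coef2 1 2 q * (z.1 * z.2 ^+ 2) + coef2 0 3 q * z.2 ^+ 3.
Proof.
move=> /mpoly.dhomogP q3.
rewrite (@eval2_coef R q [:: (3, 0); (2, 1); (1, 2); (0, 3)]%N) //; last first.
  move=> k /q3 /=; rewrite mdeg2.
  by case: (k ord0) => [|[|[|[|?]]]] //; case: (k ord_max) => [|[|[|[|?]]]].
by rewrite !big_cons big_nil /=; ring.
Qed.

(** * Barycentric coordinates, nodes and unisolvence *)

Lemma sum3 {R : realType} (F : 'I_3 -> R) :
  \sum_(i < 3) F i = F (inord 0) + F (inord 1) + F (inord 2).
Proof.
rewrite !big_ord_recl big_ord0 addr0 addrA.
by congr (F _ + F _ + F _); apply: val_inj; rewrite /= inordK.
Qed.

(** Cramer's rule for the weights of the second and third vertices; the first weight is the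
    complement to 1, and [D] is twice the signed area. *)
Definition bary {R : realType} (T : triangle R) (z : R * R) (i : 'I_3) : R :=
  let A := T (inord 0) in
  let B := T (inord 1) in
  let C := T (inord 2) in
  let D := (B.1 - A.1) * (C.2 - A.2) - (B.2 - A.2) * (C.1 - A.1) in
  let l1 := ((z.1 - A.1) * (C.2 - A.2) - (z.2 - A.2) * (C.1 - A.1)) / D in
  let l2 := ((B.1 - A.1) * (z.2 - A.2) - (B.2 - A.2) * (z.1 - A.1)) / D in
  [:: 1 - l1 - l2; l1; l2]`_i.

Lemma triangle_neq0 {R : realType} (T : triangle R) :
  let A := T (inord 0) in
  let B := T (inord 1) in
  let C := T (inord 2) in
  (B.1 - A.1) * (C.2 - A.2) - (B.2 - A.2) * (C.1 - A.1) != 0.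
Proof. by case: T. Qed.

Lemma baryP {R : realType} (T : triangle R) (z : R * R) : barycentric T (bary T z) z.
Proof.
have := triangle_neq0 T; rewrite /= => D0.
split; rewrite !sum3 /bary !inordK //=; first by ring.
by case: z => x y; congr pair => /=; field.
Qed.

(** Cramer's formulas applied to the combination return its weights. This removes the existential
    weights from [tset] and [nodes]. *)
Lemma bary_unique {R : realType} (T : triangle R) (l : 'I_3 -> R) (z : R * R) :
  barycentric T l z -> bary T z = l.
Proof.
have := triangle_neq0 T; rewrite /= => D0 [+ ->]; rewrite !sum3 => e.
have l0 : l (inord 0) = 1 - l (inord 1) - l (inord 2) by rewrite -e; ring.
apply/funext => i; rewrite -(inord_val i).
by case: i => [[|[|[|//]]] hi]; rewrite /bary !inordK //= ?l0; field.
Qed.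

Lemma tsetE {R : realType} (T : triangle R) :
  tset T = [set z | forall i, 0 <= bary T z i].
Proof.
apply/seteqP; split=> z /=; first by move=> [l [/bary_unique -> ]].
by move=> l0; exists (bary T z); split=> //; exact: baryP.
Qed.

Lemma nodes_simplex {R : realType} (m : nat) (T : triangle R) (k : nat * nat * nat) :
  (0 < m.-1)%N -> (k.1.1 + k.1.2 + k.2 = m.-1)%N ->
  let w n := n%:R / m.-1%:R in
  let A := T (inord 0) in
  let B := T (inord 1) in
  let C := T (inord 2) in
  nodes m T (w k.1.1 * A.1 + w k.1.2 * B.1 + w k.2 * C.1,
             w k.1.1 * A.2 + w k.1.2 * B.2 + w k.2 * C.2).
Proof.
move=> m0 km w A B C; pose s := [:: k.1.1; k.1.2; k.2].
have mR : (m.-1%:R : R) != 0 by rewrite pnatr_eq0 -lt0n.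
exists (fun i : 'I_3 => w (nth 0%N s i)); split.
  rewrite /barycentric !sum3 !inordK //=; split=> //.
  by rewrite /w -!mulrDl -!natrD km divff.
move=> i; exists (nth 0%N s i) => //; rewrite -km.
by case: i => [[|[|[|//]]] hi] /=; lia.
Qed.

(** An affine function takes at a point the barycentric combination of its values at the three
    vertices, which are nodes. *)
Lemma Pdeg2_unisolvent {R : realType} (T : triangle R) (q : poly2 R) :
  q \in Pdeg 2 -> (forall z, nodes 2 T z -> eval2 q z = 0) ->
  forall z, eval2 q z = 0.
Proof.
move=> q2 q0 z.
have n k e := q0 _ (@nodes_simplex R 2 T k isT e); rewrite /= in n.
have := n (1, 0, 0)%N erefl; have := n (0, 1, 0)%N erefl; have := n (0, 0, 1)%N erefl.
have [l1 ->] := baryP T z; move: l1; rewrite !sum3; set l := bary T z => l1.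
have l0 : l (inord 0) = 1 - l (inord 1) - l (inord 2) by rewrite -l1; ring.
rewrite !Pdeg2E //= => h2 h1 h0; rewrite l0.
(* [h] is zero, written with one zero in the place of each vertex value so that the vanishing
   hypotheses can be substituted there. *)
pose h := (1 - l (inord 1) - l (inord 2)) * 0 + l (inord 1) * 0 + l (inord 2) * (0 : R).
transitivity h; last by rewrite /h; ring.
by rewrite /h -{1}h0 -{1}h1 -{1}h2; field.
Qed.

(** The six nodes used are the vertices and the edge midpoints. Their Lagrange basis is l_i (2 l_i -
    1) and 4 l_i l_j. *)
Lemma Pdeg3_unisolvent {R : realType} (T : triangle R) (q : poly2 R) :
  q \in Pdeg 3 -> (forall z, nodes 3 T z -> eval2 q z = 0) ->
  forall z, eval2 q z = 0.
Proof.
move=> q3 q0 z.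
have n k e := q0 _ (@nodes_simplex R 3 T k isT e); rewrite /= in n.
have := n (2, 0, 0)%N erefl; have := n (0, 2, 0)%N erefl; have := n (0, 0, 2)%N erefl.
have := n (1, 1, 0)%N erefl; have := n (1, 0, 1)%N erefl; have := n (0, 1, 1)%N erefl.
have [l1 ->] := baryP T z; move: l1; rewrite !sum3.
move: (bary T z (inord 0)) (bary T z (inord 1)) (bary T z (inord 2)) => a b c.
move=> l1; have {l1} -> : a = 1 - b - c by rewrite -l1; ring.
rewrite !Pdeg3E //=.
move: (T (inord 0)) (T (inord 1)) (T (inord 2)) => [A1 A2] [B1 B2] [C1 C2] /=.
move: (coef2 0 0 q) (coef2 1 0 q) (coef2 0 1 q) (coef2 2 0 q) (coef2 1 1 q) (coef2 0 2 q).
move=> c0 c1 c2 c3 c4 c5.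
move=> h12 h02 h01 h2 h1 h0.
(* Lagrange's quadratic interpolation formula in barycentric coordinates. *)
have lagrange v2 v1 v0 v01 v02 v12 : v2 = 0 -> v1 = 0 -> v0 = 0 -> v01 = 0 -> v02 = 0 ->
  v12 = 0 ->
   0 = (1 - b - c) * (1 - 2 * b - 2 * c) * v0 + b * (2 * b - 1) * v1
     + c * (2 * c - 1) * v2 + 4 * (1 - b - c) * b * v01 + 4 * (1 - b - c) * c * v02 + 4 * b * c * v12.
  by move=> -> -> -> -> -> ->; ring.
rewrite [RHS](lagrange _ _ _ _ _ _ h2 h1 h0 h01 h02 h12); by field.
Qed.

Lemma nodesP {R : realType} (m : nat) (T : triangle R) (z : R * R) :
  nodes m T z <->
  forall i, exists2 k : nat, (k <= m.-1)%N & bary T z i = k%:R / m.-1%:R.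
Proof.
split=> [[l [/bary_unique -> ]]//|h].
by exists (bary T z); split=> //; exact: baryP.
Qed.

(** * Interpolation under linear maps and scaling *)

Lemma lin_triangle_subproof {R : realType} (a b c d : R) (e : a * d - b * c = 1)
    (T : triangle R) (V := fun i => lin a b c d (T i)) :
  let A := V (inord 0) in
  let B := V (inord 1) in
  let C := V (inord 2) in
  (B.1 - A.1) * (C.2 - A.2) - (B.2 - A.2) * (C.1 - A.1) != 0.
Proof.
have := triangle_neq0 T; rewrite /= -[X in X != 0]mul1r -e.
congr (is_true (_ != _)); rewrite /V /=; ring.
Qed.

Definition lin_triangle {R : realType} (a b c d : R) (e : a * d - b * c = 1)
    (T : triangle R) : triangle R :=
  Triangle (lin_triangle_subproof e T).

(** Linear maps commute with combinations of the vertices; hence they carry triangles to triangles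
    and nodes to nodes. *)
Lemma bary_lin {R : realType} (a b c d : R) (e : a * d - b * c = 1)
    (T : triangle R) (z : R * R) :
  bary (lin_triangle e T) (lin a b c d z) = bary T z.
Proof.
apply: bary_unique; have [l1 zE] := baryP T z; split=> //.
by rewrite [in LHS]zE !sum3 /lin /=; congr pair; ring.
Qed.

Lemma tset_lin {R : realType} (a b c d : R) (e : a * d - b * c = 1) (T : triangle R) :
  lin a b c d @^-1` tset (lin_triangle e T) = tset T.
Proof. by rewrite !tsetE; apply/seteqP; split=> z /=; rewrite bary_lin. Qed.

Lemma nodes_lin {R : realType} (m : nat) (a b c d : R) (e : a * d - b * c = 1)
    (T : triangle R) (z : R * R) :
  nodes m (lin_triangle e T) (lin a b c d z) <-> nodes m T z.
Proof. by rewrite !nodesP bary_lin. Qed.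

Lemma linV {R : realType} (a b c d : R) : a * d - b * c = 1 ->
  lin a b c d \o lin d (- b) (- c) a = id.
Proof.
move=> e; rewrite lin_comp; apply/funext => -[x y]; rewrite /lin /=.
by congr pair; [rewrite -[RHS]mul1r -e|rewrite -[RHS]mul1r -e]; ring.
Qed.

(** The uniqueness half of unisolvence, abstracted over [m] so that the invariance arguments are
    made once and used for degrees 2 and 3. *)
Definition unisolvent (R : realType) (m : nat) : Prop :=
  forall (T : triangle R) (q : poly2 R), q \in Pdeg m ->
    (forall z, nodes m T z -> eval2 q z = 0) -> forall z, eval2 q z = 0.

Lemma eval2B {R : realType} (q r : poly2 R) (z : R * R) :
  eval2 (q - r) z = eval2 q z - eval2 r z.
Proof. exact: mpoly.mevalB. Qed.

Lemma PdegB {R : realType} (m : nat) (q r : poly2 R) :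
  q \in Pdeg m -> r \in Pdeg m -> q - r \in Pdeg m.
Proof.
rewrite !inE => qm rm; apply: leq_trans (mpoly.msizeD_le _ _) _.
by rewrite geq_max qm mpoly.msizeN.
Qed.

(** The difference of two interpolants lies in [Pdeg m] and vanishes at the nodes. *)
Lemma interp_unique {R : realType} (m : nat) (T : triangle R) (v : R * R -> R)
    (q : poly2 R) :
  unisolvent R m -> q \in Pdeg m -> (forall z, nodes m T z -> eval2 q z = v z) ->
  eval2 (interp m T v) =1 eval2 q.
Proof.
move=> um qm qv z; rewrite /interp.
case: xgetP => [r _ [rm rv]|/(_ q) []//].
apply/eqP; rewrite -subr_eq0 -eval2B; apply/eqP; apply: (um T); first exact: PdegB.
by move=> w nw; rewrite eval2B rv // qv // subrr.
Qed.

(* When [v] has no interpolant on [T], [xget] yields 0 on both sides. *)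
Lemma interp_lin {R : realType} (m : nat) (a b c d : R) (e : a * d - b * c = 1)
    (T : triangle R) (v : R * R -> R) (z : R * R) :
  unisolvent R m ->
  eval2 (interp m T (v \o lin a b c d)) z =
  eval2 (interp m (lin_triangle e T) v) (lin a b c d z).
Proof.
move=> um; rewrite {2}/interp; case: xgetP => [r _ [rm rv]|none].
  have [q qm qE] := @Pdeg_lin R m a b c d r rm.
  rewrite -qE; apply: interp_unique => // w nw.
  by rewrite qE rv //; exact/nodes_lin.
rewrite /interp xgetPN; first by rewrite /eval2 !mpoly.meval0.
(* An interpolant on [T] composed with the inverse matrix would interpolate [v] on the image
   triangle, against [none]. *)
move=> q [qm qv]; have [r rm rE] := @Pdeg_lin R m d (- b) (- c) a q qm.
apply: (none r); split=> // w nw.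
have wE : lin a b c d (lin d (- b) (- c) a w) = w by have /= := congr1 (@^~ w) (linV e).
rewrite rE qv /= ?wE //.
by apply/(nodes_lin m e); rewrite wE.
Qed.

Lemma interpZ {R : realType} (m : nat) (k : R) (T : triangle R) (v : R * R -> R)
    (z : R * R) :
  unisolvent R m -> k != 0 ->
  eval2 (interp m T (fun w => k * v w)) z = k * eval2 (interp m T v) z.
Proof.
move=> um k0; rewrite {2}/interp; case: xgetP => [r _ [rm rv]|none].
  rewrite -eval2Z; apply: interp_unique => //; first exact: PdegZ.
  by move=> w nw; rewrite eval2Z rv.
rewrite /interp xgetPN; first by rewrite /eval2 !mpoly.meval0 mulr0.
(* An interpolant of the scaled function, divided by [k], would interpolate [v]; so both sides are
   the default 0. *)
move=> q [qm qv]; apply: (none (k^-1 *: q)); split; first exact: PdegZ.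
by move=> w nw; rewrite eval2Z qv // mulKf.
Qed.

(** * Measurability, SL_2-invariance and homogeneity of the shape function *)

Local Notation plane R := (measurableTypeR R * measurableTypeR R)%type.

Lemma measurable_eval2 {R : realType} (q : poly2 R) :
  measurable_fun setT (eval2 q : plane R -> measurableTypeR R).
Proof.
rewrite (_ : eval2 q = fun z => \sum_(m <- mpoly.msupp q)
    mpoly.mcoeff m q * (z.1 ^+ m ord0 * z.2 ^+ m ord_max)); last first.
  by apply/funext => z; rewrite eval2E.
apply: measurable_sum => m; apply: measurable_funM => //.
by apply: measurable_funM; apply: measurable_funX.
Qed.

Lemma measurable_bary {R : realType} (T : triangle R) (i : 'I_3) :
  measurable_fun setT ((fun z => bary T z i) : plane R -> measurableTypeR R).
Proof.
(* Each barycentric coordinate is affine, with coefficients read off at the origin and the two unit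
   vectors. *)
have [[u0 [u1 u2]] uE] : exists u : R * (R * R), forall z,
    bary T z i = u.1 + u.2.1 * z.1 + u.2.2 * z.2.
  have := triangle_neq0 T; rewrite /= => D0.
  exists (bary T (0, 0) i, (bary T (1, 0) i - bary T (0, 0) i,
                            bary T (0, 1) i - bary T (0, 0) i)) => z /=.
  by case: i => [[|[|[|//]]] hi]; rewrite /bary /=; field.
under eq_fun do rewrite uE.
by apply: measurable_funD; [apply: measurable_funD|] => //; apply: measurable_funM.
Qed.

Lemma measurable_tset {R : realType} (T : triangle R) :
  measurable (tset T : set (plane R)).
Proof.
rewrite tsetE (_ : mkset _ = \bigcap_(i in setT) ((fun z => bary T z i) @^-1` `[0, +oo[)).
  apply: fin_bigcap_measurable => // i _; rewrite -[X in measurable X]setTI.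
  by apply: measurable_bary => //; exact: measurable_itv.
apply/seteqP; split=> z /= zT i; first by move=> _ /=; rewrite in_itv /= andbT.
by have := zT i I; rewrite /= in_itv /= andbT.
Qed.

Lemma area_lin {R : realType} (a b c d : R) (e : a * d - b * c = 1) (T : triangle R) :
  area (lin_triangle e T) = area T.
Proof. by rewrite /area -[in RHS](tset_lin e T) leb2_lin //; exact: measurable_tset. Qed.

(** The error function on [T] is that on the image triangle composed with a measure-preserving
    map. *)
Lemma interp_error_lin {R : realType} (m : nat) (p : \bar R) (a b c d : R)
    (e : a * d - b * c = 1) (T : triangle R) (v : R * R -> R) :
  unisolvent R m -> (0 <= p)%E ->
  measurable_fun setT (v : plane R -> measurableTypeR R) ->
  interp_error m p T (v \o lin a b c d) = interp_error m p (lin_triangle e T) v.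
Proof.
move=> um p0 mv; rewrite /interp_error.
set f := EFin \o _; set g := EFin \o _.
have -> : f = g \o lin a b c d.
  apply/funext => z; rewrite /f /g /= !patchE.
  rewrite (_ : (z \in tset T) = (lin a b c d z \in tset (lin_triangle e T))).
    by rewrite interp_lin.
  by rewrite -(tset_lin e); apply/idP/idP; rewrite !inE.
apply: Lnorm_pushforward => //.
- by move=> A mA; exact: leb2_lin.
- exact: measurable_lin.
apply/measurable_EFinP/(measurable_restrictT _ (measurable_tset _)).
apply: measurable_funTS; apply: measurable_funB => //; exact: measurable_eval2.
Qed.

(** [shapeK] for an arbitrary function, so that composites with linear maps and multiples need no
    polynomial representative. *)
Definition shape_of {R : realType} (m : nat) (p : \bar R) (v : R * R -> R) : \bar R :=
  ereal_inf [set interp_error m p T v | T in [set T : triangle R | area T = 1%E]].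

Lemma shape_of_lin {R : realType} (m : nat) (p : \bar R) (a b c d : R)
    (v : R * R -> R) :
  a * d - b * c = 1 -> unisolvent R m -> (0 <= p)%E ->
  measurable_fun setT (v : plane R -> measurableTypeR R) ->
  shape_of m p (v \o lin a b c d) = shape_of m p v.
Proof.
move=> e um p0 mv; congr ereal_inf; apply/seteqP; split=> _ [T aT <-].
  by exists (lin_triangle e T); rewrite ?interp_error_lin //= area_lin.
(* The inverse matrix also has determinant 1 and yields the other inclusion. *)
have e' : d * a - - b * - c = 1 by rewrite -e; ring.
exists (lin_triangle e' T); rewrite /= ?area_lin //.
rewrite -interp_error_lin //; first by rewrite -compA linV.
by apply: measurableT_comp => //; exact: measurable_lin.
Qed.

Lemma LnormZ_ge1 d (T : measurableType d) (R : realType)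
    (mu : {measure set T -> \bar R}) (p : \bar R) (k : R) (f : T -> R) :
  (1 <= p)%E -> k != 0 -> measurable_fun setT f ->
  Lnorm mu p (EFin \o (fun z => k * f z)) = (`|k|%:E * Lnorm mu p (EFin \o f))%E.
Proof.
move=> p1 k0 mf; rewrite unlock; case: p p1 => [r r1|_|//]; last first.
  case: ifP => _; last by rewrite mule0.
  rewrite -ess_sup_pZl ?normr_gt0 //; congr ess_sup.
  by apply/funext => z; rewrite /= normrM EFinM.
have r0 : 0 < r by rewrite -lte_fin; apply: lt_le_trans r1; rewrite lte_fin.
have -> : (\int[mu]_x (`|(EFin \o (fun z : T => k * f z)%R) x| `^ r) =
    (`|k| `^ r)%:E * \int[mu]_x (`|(EFin \o f) x| `^ r))%E.
  rewrite -ge0_integralZl //=.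
  - by apply: eq_integral => x _; rewrite normrM powRM.
  - apply/measurable_EFinP.
    apply: (@measurableT_comp _ _ _ _ _ _ (@powR R ^~ r)) => //.
    exact: measurableT_comp.
rewrite poweRM ?lee_fin ?powR_ge0 //; last by apply: integral_ge0 => x _; exact: poweR_ge0.
by rewrite poweR_EFin -powRrM mulfV ?gt_eqF // powRr1.
Qed.

Lemma shape_ofZ {R : realType} (m : nat) (p : \bar R) (k : R) (v : R * R -> R) :
  (1 <= p)%E -> k != 0 -> unisolvent R m ->
  measurable_fun setT (v : plane R -> measurableTypeR R) ->
  shape_of m p (fun z => k * v z) = (`|k|%:E * shape_of m p v)%E.
Proof.
move=> p1 k0 um mv; rewrite /shape_of -ereal_inf_pZl ?normr_gt0 // image_comp.
congr ereal_inf; apply: eq_imagel => T _ /=.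
rewrite /interp_error -LnormZ_ge1 //; last first.
  apply/(measurable_restrictT _ (measurable_tset _)).
  apply: measurable_funTS; apply: measurable_funB => //; exact: measurable_eval2.
congr Lnorm; apply/funext => z; rewrite /= !patchE.
by case: ifP; rewrite ?mulr0 // interpZ // mulrBr.
Qed.

(** * Finiteness of the shape function *)

Lemma Lnorm_bounded_lty d (T : measurableType d) (R : realType)
    (mu : {measure set T -> \bar R}) (p : \bar R) (f : T -> R) (D : set T) (M : R) :
  (1 <= p)%E -> measurable D -> (mu D < +oo)%E -> measurable_fun setT f ->
  (forall z, D z -> `|f z| <= M) ->
  (Lnorm mu p (EFin \o (f \_ D)) < +oo)%E.
Proof.
move=> p1 mD D_fin mf fM.
(* The bound is [|M|] because it must also hold outside [D], where the value is 0, while [M] may be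
   negative if [D] is empty. *)
have M0 z : `|(f \_ D) z| <= `|M|.
  rewrite patchE; case: ifPn => [/set_mem/fM zM|_]; last by rewrite normr0.
  exact: le_trans zM (ler_norm _).
rewrite unlock; case: p p1 => [r r1|_|//]; last first.
  case: ifP => // _; apply: le_lt_trans (ltry `|M|).
  by apply/ess_supP; apply: nearW => z; rewrite /= lee_fin.
have r0 : 0 < r by rewrite -lte_fin; apply: lt_le_trans r1; rewrite lte_fin.
apply: poweR_lty.
apply: (@le_lt_trans _ _ (\int[mu]_(x in D) (cst (`|M| `^ r)%:E x))%E); last first.
  by rewrite integral_cst // lte_mul_pinfty // lee_fin powR_ge0.
rewrite [leRHS]integral_mkcond; apply: ge0_le_integral => //.
- by move=> z _; exact: poweR_ge0.
- apply/measurable_EFinP.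
  apply: (@measurableT_comp _ _ _ _ _ _ (@powR R ^~ r)) => //.
  apply: measurableT_comp => //; apply/(measurable_restrictT _ mD).
  exact: measurable_funTS.
- by apply/(measurable_restrictT _ mD).
move=> z _; have := M0 z; rewrite /= !patchE; case: ifP => _ zM.
  by rewrite lee_fin ge0_ler_powR ?nnegrE // ltW.
by rewrite normr0 powR0 ?gt_eqF.
Qed.

(** Barycentric weights in a triangle are at most 1, so [B] bounds both coordinates, and the
    monomials are bounded termwise. *)
Lemma eval2_bounded {R : realType} (T : triangle R) (q : poly2 R) :
  exists M : R, forall z, tset T z -> `|eval2 q z| <= M.
Proof.
pose B : R := \sum_(i < 3) (`|(T i).1| + `|(T i).2|).
have lB (g : 'I_3 -> R) (l : 'I_3 -> R) : \sum_(i < 3) l i = 1 -> (forall i, 0 <= l i) ->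
    (forall i, `|g i| <= `|(T i).1| + `|(T i).2|) -> `|\sum_(i < 3) l i * g i| <= B.
  move=> l1 l0 gT; apply: le_trans (ler_norm_sum _ _ _) _.
  apply: ler_sum => i _; rewrite normrM ger0_norm //; apply: le_trans (gT i).
  rewrite ler_piMl // -l1 (bigD1 i) //= lerDl; exact: sumr_ge0.
exists (\sum_(m <- mpoly.msupp q) `|mpoly.mcoeff m q| * (B ^+ m ord0 * B ^+ m ord_max)).
move=> z [l [[l1 ->] l0]]; rewrite eval2E; apply: le_trans (ler_norm_sum _ _ _) _.
apply: ler_sum => m _; rewrite !normrM !normrX ler_wpM2l // ler_pM ?exprn_ge0 //=;
  rewrite lerXn2r ?nnegrE //=; try (by rewrite sumr_ge0 // => i _; rewrite addr_ge0);
  by apply: lB => // i; rewrite ?lerDl ?lerDr.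
Qed.

(** A witness that triangles of area 1 exist; its vertical section over x in [0, 1] is [0, 2x],
    which makes the area the integral of 2x. *)
Definition unit_area_vertex {R : realType} (i : 'I_3) : R * R :=
  [:: (0, 0); (1, 0); (1, 2)]`_i.

Lemma unit_area_subproof {R : realType} (V := @unit_area_vertex R) :
  let A := V (inord 0) in
  let B := V (inord 1) in
  let C := V (inord 2) in
  (B.1 - A.1) * (C.2 - A.2) - (B.2 - A.2) * (C.1 - A.1) != 0.
Proof.
by rewrite /V /unit_area_vertex !inordK //= !subr0 mul1r mul0r subr0 pnatr_eq0.
Qed.

Definition unit_area_triangle (R : realType) : triangle R :=
  Triangle (@unit_area_subproof R).

Lemma unit_area_tset {R : realType} :
  tset (unit_area_triangle R) = [set z | [/\ z.1 <= 1, 0 <= z.2 & z.2 <= 2 * z.1]].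
Proof.
have D2 : (1 - 0) * (2 - 0) - (0 - 0) * (1 - 0) = 2 :> R by ring.
rewrite tsetE; apply/seteqP; split=> z /=.
  move=> h; have := (h (inord 0), h (inord 1), h (inord 2)).
  rewrite /bary /= /unit_area_vertex !inordK //= !D2 => -[[h0 h1] h2].
  split; lra.
case=> h0 h1 h2 i; rewrite /bary /= /unit_area_vertex !inordK //= !D2.
case: i => [[|[|[|//]]] hi] /=; lra.
Qed.

Lemma area_unit_area {R : realType} : area (unit_area_triangle R) = 1%E.
Proof.
rewrite /area unit_area_tset /leb2 /= /product_measure1.
transitivity (\int[@lebesgue_measure R]_(x in `[0%R, 1%R]) (2 * x)%:E)%E.
  rewrite [RHS]integral_mkcond; apply: eq_integral => x _ /=.
  rewrite patchE mem_setE in_itv /=; have [/andP[x0 x1]|x01] := ifPn.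
    have -> : xsection [set z : R * R | [/\ z.1 <= 1, 0 <= z.2 & z.2 <= 2 * z.1]] x
        = `[0, 2 * x]%classic.
      apply/seteqP; split=> y; rewrite /xsection /= inE /= in_itv /=.
        by move=> [_ -> ->].
      by move=> /andP[].
    rewrite lebesgue_measure_itv /= lte_fin; case: ltP => [_|h].
      by rewrite sube0.
    by congr (_%:E); lra.
  rewrite (_ : xsection _ _ = set0) ?measure0 //.
  apply/seteqP; split=> y //; rewrite /xsection /= inE /= => -[x1 y0 yx].
  by move: x01; rewrite x1 andbT -ltNge => ?; lra.
rewrite (@continuous_FTC2 _ _ (fun x : R => x ^+ 2)) //.
- by rewrite expr1n expr0n /= sube0.
- by apply: continuous_subspaceT => x; exact: mulrl_continuous.
- split=> [x _||]; first exact: exprn_derivable.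
  + by apply: cvg_at_right_filter; exact: exprn_continuous.
  + by apply: cvg_at_left_filter; exact: exprn_continuous.
- by move=> x _; rewrite exp_derive1 expr1.
Qed.

Lemma shape_of_ge0 {R : realType} (m : nat) (p : \bar R) (v : R * R -> R) :
  (0 <= shape_of m p v)%E.
Proof. by apply: le_ereal_inf_tmp => _ [T _ <-]; exact: Lnorm_ge0. Qed.

(** The infimum is nonnegative and at most the error on one triangle of area 1, where the integrand
    is bounded. *)
Lemma shape_of_fin {R : realType} (m : nat) (p : \bar R) (q : poly2 R) :
  (1 <= p)%E -> shape_of m p (eval2 q) \is a fin_num.
Proof.
move=> p1; rewrite ge0_fin_numE; last first.
  exact: shape_of_ge0.
pose T := unit_area_triangle R.
apply: (@le_lt_trans _ _ (interp_error m p T (eval2 q))).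
  by apply: ereal_inf_lbound; exists T => //; exact: area_unit_area.
have [M TM] := eval2_bounded T (q - interp m T (eval2 q)).
apply: (@Lnorm_bounded_lty _ _ _ _ _ _ _ M) => //.
- exact: measurable_tset.
- by rewrite -/(area T) area_unit_area ltry.
- by apply: measurable_funB; exact: measurable_eval2.
- by move=> z zT; rewrite -eval2B; exact: TM.
Qed.

(** * Binary quadratic and cubic forms as functions *)

(** Here [b] is the full coefficient of xy, so the determinant reads [a * c - (b / 2) ^+ 2]. *)
Definition form2 {R : realType} (a b c : R) (z : R * R) : R :=
  a * z.1 ^+ 2 + b * (z.1 * z.2) + c * z.2 ^+ 2.

Definition form3 {R : realType} (a b c d : R) (z : R * R) : R :=
  a * z.1 ^+ 3 + b * (z.1 ^+ 2 * z.2) + c * (z.1 * z.2 ^+ 2) + d * z.2 ^+ 3.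

Definition monomial {R : realType} (i j : nat) : poly2 R :=
  mpoly.mpolyX R (mpoly.Multinom [tuple i; j]).

Lemma eval2_monomial {R : realType} (i j : nat) (z : R * R) :
  eval2 (monomial i j) z = z.1 ^+ i * z.2 ^+ j.
Proof.
rewrite /eval2 mpoly.mevalX big_ord_recl big_ord1 /=.
by rewrite !mpoly.multinomE !(tnth_nth 0%N).
Qed.

Lemma eval2D {R : realType} (q r : poly2 R) (z : R * R) :
  eval2 (q + r) z = eval2 q z + eval2 r z.
Proof. exact: mpoly.mevalD. Qed.

Lemma form2_eval2 {R : realType} (a b c : R) :
  exists q : poly2 R, form2 a b c = eval2 q.
Proof.
exists (a *: monomial 2 0 + b *: monomial 1 1 + c *: monomial 0 2).
by apply/funext => z; rewrite !eval2D !eval2Z !eval2_monomial /form2; ring.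
Qed.

Lemma form3_eval2 {R : realType} (a b c d : R) :
  exists q : poly2 R, form3 a b c d = eval2 q.
Proof.
exists (a *: monomial 3 0 + b *: monomial 2 1 + c *: monomial 1 2 + d *: monomial 0 3).
by apply/funext => z; rewrite !eval2D !eval2Z !eval2_monomial /form3; ring.
Qed.

Lemma measurable_form2 {R : realType} (a b c : R) :
  measurable_fun setT (form2 a b c : plane R -> measurableTypeR R).
Proof. by have [q ->] := form2_eval2 a b c; exact: measurable_eval2. Qed.

Lemma measurable_form3 {R : realType} (a b c d : R) :
  measurable_fun setT (form3 a b c d : plane R -> measurableTypeR R).
Proof. by have [q ->] := form3_eval2 a b c d; exact: measurable_eval2. Qed.

(** * Reduction to normal forms under SL_2 and scaling *)

Section normal_forms.
Context {R : realType} (p : \bar R) (p1 : (1 <= p)%E).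

Let p0 : (0 <= p)%E. Proof. exact: le_trans p1. Qed.

(** Finiteness excludes the fixed point at infinity. This serves for degenerate forms, which some
    SL_2 map multiplies by [k]. *)
Lemma shape_of_scaled_eq0 (m : nat) (k : R) (x : \bar R) :
  `|k| != 1 -> x \is a fin_num -> x = (`|k|%:E * x)%E -> x = 0%E.
Proof.
move=> k1; case: x => //= r _ [] /eqP; rewrite -subr_eq0 -[X in X - _]mul1r -mulrBl.
by rewrite mulf_eq0 subr_eq0 eq_sym (negbTE k1) => /eqP ->.
Qed.

Local Notation K2 a b c := (shape_of 2 p (form2 a b c)).
Local Notation K3 a b c d := (shape_of 3 p (form3 a b c d)).

Lemma K2_fin (a b c : R) : K2 a b c \is a fin_num.
Proof. by have [q ->] := form2_eval2 a b c; exact: shape_of_fin. Qed.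

Lemma K3_fin (a b c d : R) : K3 a b c d \is a fin_num.
Proof. by have [q ->] := form3_eval2 a b c d; exact: shape_of_fin. Qed.

(** The coefficients arise from substituting [s x + t y] for x and [u x + v y] for y. *)
Lemma K2_lin (s t u v a b c : R) : s * v - t * u = 1 ->
  K2 (a * s ^+ 2 + b * (s * u) + c * u ^+ 2)
     (2 * a * (s * t) + b * (s * v + t * u) + 2 * c * (u * v))
     (a * t ^+ 2 + b * (t * v) + c * v ^+ 2) = K2 a b c.
Proof.
move=> e; rewrite -(@shape_of_lin R 2 p s t u v (form2 a b c)) //.
- by congr shape_of; apply/funext => z; rewrite /form2 /lin /=; ring.
- exact: Pdeg2_unisolvent.
- exact: measurable_form2.
Qed.

Lemma K3_lin (s t u v a b c d : R) : s * v - t * u = 1 ->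
  K3 (a * s ^+ 3 + b * (s ^+ 2 * u) + c * (s * u ^+ 2) + d * u ^+ 3)
     (3 * a * (s ^+ 2 * t) + b * (s ^+ 2 * v + 2 * s * t * u)
      + c * (2 * s * u * v + t * u ^+ 2) + 3 * d * (u ^+ 2 * v))
     (3 * a * (s * t ^+ 2) + b * (2 * s * t * v + t ^+ 2 * u)
      + c * (s * v ^+ 2 + 2 * t * u * v) + 3 * d * (u * v ^+ 2))
     (a * t ^+ 3 + b * (t ^+ 2 * v) + c * (t * v ^+ 2) + d * v ^+ 3) = K3 a b c d.
Proof.
move=> e; rewrite -(@shape_of_lin R 3 p s t u v (form3 a b c d)) //.
- by congr shape_of; apply/funext => z; rewrite /form3 /lin /=; ring.
- exact: Pdeg3_unisolvent.
- exact: measurable_form3.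
Qed.

Lemma K2Z (k a b c : R) : k != 0 ->
  K2 (k * a) (k * b) (k * c) = (`|k|%:E * K2 a b c)%E.
Proof.
move=> k0; rewrite -shape_ofZ //.
- by congr shape_of; apply/funext => z; rewrite /form2; ring.
- exact: Pdeg2_unisolvent.
- exact: measurable_form2.
Qed.

Lemma K3Z (k a b c d : R) : k != 0 ->
  K3 (k * a) (k * b) (k * c) (k * d) = (`|k|%:E * K3 a b c d)%E.
Proof.
move=> k0; rewrite -shape_ofZ //.
- by congr shape_of; apply/funext => z; rewrite /form3; ring.
- exact: Pdeg3_unisolvent.
- exact: measurable_form3.
Qed.

Lemma K2_eq (a b c a' b' c' : R) : a = a' -> b = b' -> c = c' -> K2 a b c = K2 a' b' c'.
Proof. by move=> -> -> ->. Qed.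

Lemma K3_eq (a b c d a' b' c' d' : R) :
  a = a' -> b = b' -> c = c' -> d = d' -> K3 a b c d = K3 a' b' c' d'.
Proof. by move=> -> -> -> ->. Qed.

(** A diagonal map makes both coefficients equal in absolute value to [r]; dividing by
    [Num.sg a * r] leaves x^2 + sg(ac) y^2. *)
Lemma K2_diagonal (a c : R) : a != 0 ->
  K2 a 0 c = (K2 1 0 (Num.sg (a * c)) * (Num.sqrt `|a * c|)%:E)%E.
Proof.
move=> a0; have [->|c0] := eqVneq c 0.
  rewrite mulr0 normr0 sqrtr0 mule0.
  (* diag(2, 1/2) multiplies a x^2 by 4. *)
  apply: (@shape_of_scaled_eq0 2 4); [by rewrite normr_nat pnatr_eq1|exact: K2_fin|].
  rewrite -K2Z // -(@K2_lin 2 0 0 2^-1 a 0 0); last by field.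
  by apply: K2_eq; field.
set r := Num.sqrt _; have r0 : 0 < r by rewrite sqrtr_gt0 normr_gt0 mulf_neq0.
have rE : r ^+ 2 = `|a| * `|c| by rewrite sqr_sqrtr // normrM.
have na0 : 0 < `|a| by rewrite normr_gt0.
(* Chosen so that |a| l^2 = |c| / l^2 = r. *)
pose l := Num.sqrt (r / `|a|).
have l2 : l ^+ 2 = r / `|a| by rewrite sqr_sqrtr // divr_ge0 // ltW.
have l0 : l != 0 by rewrite sqrtr_eq0 -ltNge divr_gt0.
rewrite -(@K2_lin l 0 0 l^-1); last by field.
have k0 : Num.sg a * r != 0 by rewrite mulf_neq0 ?sgr_eq0 // gt_eqF.
have -> : r = `|Num.sg a * r| by rewrite normrM normr_sg a0 mul1r gtr0_norm.
rewrite muleC -K2Z //; apply: K2_eq.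
- rewrite l2 {1}[a]numEsg; field; exact: lt0r_neq0.
- by ring.
- rewrite exprVn l2 {1}[c]numEsg sgrM.
  have -> : Num.sg a * r * (Num.sg a * Num.sg c) = (Num.sg a ^+ 2) * Num.sg c * r by ring.
  rewrite sqr_sg a0 mul1r; apply: (mulIf (lt0r_neq0 r0)).
  rewrite -[RHS]mulrA -expr2 rE; field.
  by rewrite l0 andbT !lt0r_neq0.
Qed.

(** If [a] is nonzero, complete the square. Otherwise a quarter turn brings a nonzero [c] to the
    front, or a shear turns b xy into b x^2 + b xy; the zero form equals its own double. *)
Lemma K2E (a b c : R) : let D := a * c - (b / 2) ^+ 2 in
  K2 a b c = (K2 1 0 (Num.sg D) * (Num.sqrt `|D|)%:E)%E.
Proof.
have nz a' b' c' : a' != 0 -> let D := a' * c' - (b' / 2) ^+ 2 in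
    K2 a' b' c' = (K2 1 0 (Num.sg D) * (Num.sqrt `|D|)%:E)%E.
  (* Completing the square gives a' x^2 + (D / a') y^2. *)
  move=> a0 D; have -> : D = a' * (D / a') by field.
  rewrite -K2_diagonal // -(@K2_lin 1 (- b' / (2 * a')) 0 1 a' b' c'); last by ring.
  by apply: K2_eq; rewrite /D; field.
move=> D; have [a0|] := eqVneq a 0; last by move/nz; exact.
have [c0|/nz cE] := eqVneq c 0; last first.
  rewrite -(@K2_lin 0 1 (-1) 0 a b c); last by ring.
  rewrite -[RHS](_ : K2 c (- b) a = _); first by apply: K2_eq; ring.
  by rewrite cE; have -> : c * a - (- b / 2) ^+ 2 = D by rewrite /D; ring.
have [b0|/nz bE] := eqVneq b 0; last first.
  rewrite -(@K2_lin 1 0 1 1 a b c); last by ring.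
  rewrite -[RHS](_ : K2 b b 0 = _); first by apply: K2_eq; rewrite ?a0 ?c0; ring.
  by rewrite bE; have -> : b * 0 - (b / 2) ^+ 2 = D by rewrite /D a0; ring.
have -> : D = 0 by rewrite /D a0 b0; ring.
rewrite normr0 sqrtr0 mule0 a0 b0 c0.
apply: (@shape_of_scaled_eq0 2 2); [by rewrite normr_nat pnatr_eq1|exact: K2_fin|].
by rewrite -K2Z ?pnatr_eq0 // mulr0.
Qed.

(** * Cubic forms and their discriminant *)

Definition disc (a b c d : R) : R :=
  b ^+ 2 * c ^+ 2 - 4 * a * c ^+ 3 - 4 * b ^+ 3 * d
  + 18 * a * b * c * d - 27 * a ^+ 2 * d ^+ 2.

(** As in degree 2, a diagonal map and a scaling normalise both coefficients. The division by 4
    appears because x^3 - x y^2 and x^3 + x y^2 have discriminants 4 and -4. *)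
Lemma K3_diagonal (a c : R) : c != 0 ->
  K3 a 0 c 0 = (K3 1 0 (- Num.sg (disc a 0 c 0)) 0 *
                ((`|disc a 0 c 0| / 4) `^ 4^-1)%:E)%E.
Proof.
move=> c0; have discE : disc a 0 c 0 = - 4 * a * c ^+ 3 by rewrite /disc; ring.
have [a0|a0] := eqVneq a 0.
  rewrite discE a0 mulr0 mul0r normr0 mul0r powR0 ?invr_eq0 ?pnatr_eq0 // mule0.
  (* diag(2, 1/2) multiplies c x y^2 by 2 / 4. *)
  apply: (@shape_of_scaled_eq0 3 2^-1); last 1 first.
  - rewrite -K3Z ?invr_eq0 ?pnatr_eq0 // -(@K3_lin 2 0 0 2^-1 0 0 c 0); last by field.
    by apply: K3_eq; field.
  - by rewrite normfV normr_nat invr_eq1 pnatr_eq1.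
  - exact: K3_fin.
set r := _ `^ _; have D0 : 0 < `|disc a 0 c 0| / 4.
  by rewrite divr_gt0 // normr_gt0 discE !mulf_neq0 // ?oppr_eq0 ?pnatr_eq0 // expf_neq0.
have r0 : 0 < r by rewrite powR_gt0.
have rE : r ^+ 4 = `|a| * `|c| ^+ 3.
  rewrite -powR_mulrn ?powR_ge0 // -powRrM mulVf ?pnatr_eq0 // powRr1 ?ltW //.
  by rewrite discE normrM normrX normrM normrN normr_nat; field.
have nc0 : 0 < `|c| by rewrite normr_gt0.
(* Since r^4 = |a| |c|^3, this scaling gives both remaining coefficients the absolute value [r]. *)
rewrite -(@K3_lin (`|c| / r) 0 0 (r / `|c|)); last first.
  by field; rewrite !gt_eqF.
have k0 : Num.sg a * r != 0 by rewrite mulf_neq0 ?sgr_eq0 // gt_eqF.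
have -> : r%:E = `|Num.sg a * r|%:E by rewrite normrM normr_sg a0 mul1r gtr0_norm.
rewrite muleC -K3Z //; apply: K3_eq; try by ring.
- apply: (mulIf (expf_neq0 3 (lt0r_neq0 r0))).
  have -> : Num.sg a * r * 1 * r ^+ 3 = Num.sg a * r ^+ 4 by ring.
  by rewrite rE [RHS]mulrA -numEsg; field; rewrite gt_eqF.
- rewrite discE sgrM sgrM sgrX sgrN sgr_nat /=.
  have -> : Num.sg c ^+ 3 = Num.sg c by rewrite exprS sqr_sg c0 mulr1.
  have -> : Num.sg a * r * - (- 1 * Num.sg a * Num.sg c) = Num.sg a ^+ 2 * Num.sg c * r by ring.
  rewrite sqr_sg a0 mul1r; transitivity (c * (r / `|c|)).
    by field; rewrite !lt0r_neq0.
  by rewrite {1}[c]numEsg; field; rewrite lt0r_neq0.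
Qed.

(** The form is x times a quadratic. For nonzero [c], completing the square in y removes the middle
    term and reduces to the diagonal case. *)
Lemma K3_linear_factor (a b c : R) :
  K3 a b c 0 = (K3 1 0 (- Num.sg (disc a b c 0)) 0 *
                ((`|disc a b c 0| / 4) `^ 4^-1)%:E)%E.
Proof.
have [->|c0] := eqVneq c 0; last first.
  have -> : disc a b c 0 = disc (a - b ^+ 2 / (4 * c)) 0 c 0 by rewrite /disc; field.
  rewrite -K3_diagonal // -(@K3_lin 1 0 (- b / (2 * c)) 1 a b c 0); last by ring.
  by apply: K3_eq; field.
(* Now x^2 divides the form: it is a x^3, or a shear makes it b x^2 y, and diag(2, 1/2) multiplies
   these by 8 and 2. *)
have -> : disc a b 0 0 = 0 by rewrite /disc; ring.
rewrite normr0 mul0r powR0 ?invr_eq0 ?pnatr_eq0 // mule0.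
have [->|b0] := eqVneq b 0.
  apply: (@shape_of_scaled_eq0 3 8); [by rewrite normr_nat pnatr_eq1|exact: K3_fin|].
  rewrite -K3Z ?pnatr_eq0 // -(@K3_lin 2 0 0 2^-1 a 0 0 0); last by field.
  by apply: K3_eq; field.
rewrite -(_ : K3 0 b 0 0 = K3 a b 0 0).
  apply: (@shape_of_scaled_eq0 3 2); [by rewrite normr_nat pnatr_eq1|exact: K3_fin|].
  rewrite -K3Z ?pnatr_eq0 // -(@K3_lin 2 0 0 2^-1 0 b 0 0); last by field.
  by apply: K3_eq; field.
rewrite -(@K3_lin 1 0 (- a / b) 1 a b 0 0); last by ring.
by apply: K3_eq; field.
Qed.

(** The intermediate value theorem on [-M, M] for the monic cubic, with a Cauchy-type bound [M]. *)
Lemma cubic_root (a b c d : R) : a != 0 ->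
  exists x, a * x ^+ 3 + b * x ^+ 2 + c * x + d = 0.
Proof.
move=> a0; pose P : {poly R} := 'X^3 + (b / a)%:P * 'X^2 + (c / a)%:P * 'X + (d / a)%:P.
have PE x : P.[x] = x ^+ 3 + b / a * x ^+ 2 + c / a * x + d / a by rewrite /P !hornerE.
pose M := 1 + `|b / a| + `|c / a| + `|d / a|.
have bound (u v w : R) : let N := 1 + `|u| + `|v| + `|w| in
    0 <= N ^+ 3 + u * N ^+ 2 + v * N + w.
  move=> N; have N1 : 1 <= N by rewrite /N -!addrA lerDl !addr_ge0.
  have uN : - `|u| <= u by rewrite lerNl ler_normr lexx orbT.
  have vN : - `|v| <= v by rewrite lerNl ler_normr lexx orbT.
  have wN : - `|w| <= w by rewrite lerNl ler_normr lexx orbT.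
  have N2 : N <= N ^+ 2 by rewrite ler_eXnr.
  have e : N ^+ 3 + u * N ^+ 2 + v * N + w =
     N ^+ 2 + (`|u| + u) * N ^+ 2 + (`|v| * N ^+ 2 + v * N) + (`|w| * N ^+ 2 + w).
    by rewrite {1}exprSr {2}/N; ring.
  have u0 : 0 <= (`|u| + u) * N ^+ 2.
    by rewrite mulr_ge0 ?exprn_ge0 ?(le_trans _ N1) //; lra.
  have v0 : 0 <= `|v| * N ^+ 2 + v * N.
    have : `|v| * N <= `|v| * N ^+ 2 by rewrite ler_wpM2l.
    have : - `|v| * N <= v * N by rewrite ler_wpM2r // (le_trans _ N1).
    lra.
  have w0 : 0 <= `|w| * N ^+ 2 + w.
    have : `|w| * 1 <= `|w| * N ^+ 2 by rewrite ler_wpM2l // (le_trans N1).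
    lra.
  by rewrite e; have := exprn_ge0 2 (le_trans ler01 N1); lra.
have M1 : 1 <= M by rewrite /M -!addrA lerDl !addr_ge0.
have [|/=|x _ /rootP] := @poly_ivt R P (- M) M.
- by lra.
- rewrite !PE; apply/andP; split; last exact: bound.
  (* The opposite of the value at -M is the value at M of the cubic with its quadratic and constant
     coefficients negated, and [M] is the same for both. *)
  have := bound (- (b / a)) (c / a) (- (d / a)); rewrite /= !normrN -/M => h.
  rewrite -oppr_ge0; apply: le_trans h _; rewrite le_eqVlt; apply/orP; left.
  by apply/eqP; ring.
rewrite PE => /(congr1 (fun t => a * t)); rewrite mulr0 => <-.
by exists x; field.
Qed.

(** A real linear factor is moved to x. If [a] is 0 the factor is y and a quarter turn suffices;
    otherwise a root [x] of the dehomogenised cubic gives a shear that kills the coefficient of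
    y^3. *)
Lemma K3E (a b c d : R) :
  K3 a b c d = (K3 1 0 (- Num.sg (disc a b c d)) 0 *
                ((`|disc a b c d| / 4) `^ 4^-1)%:E)%E.
Proof.
have [->|a0] := eqVneq a 0.
  have -> : disc 0 b c d = disc (- d) c (- b) 0 by rewrite /disc; ring.
  rewrite -K3_linear_factor -(@K3_lin 0 1 (-1) 0 0 b c d); last by ring.
  by apply: K3_eq; ring.
have [x] := cubic_root b c d a0; rewrite addrC => /eqP; rewrite addr_eq0 => /eqP dE.
have -> : disc a b c d = disc a (3 * a * x + b) (3 * a * x ^+ 2 + 2 * b * x + c) 0.
  by rewrite dE /disc; ring.
rewrite -K3_linear_factor -(@K3_lin 1 x 0 1 a b c d); last by ring.
by apply: K3_eq; rewrite ?dE; ring.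
Qed.

End normal_forms.

Unset Implicit Arguments.

Theorem theorem4p1 (R : realType) (p : \bar R) (hp : (1 <= p)%E) :
  exists sigma sigmastar : R -> R,
    (forall t, 0 <= sigma t) /\
    (forall t, 0 <= sigmastar t) /\
    (forall s t, Num.sg s = Num.sg t -> sigma s = sigma t) /\
    (forall s t, Num.sg s = Num.sg t -> sigmastar s = sigmastar t) /\
    (forall q : poly2 R, q \in Hdeg 2 ->
       shapeK 2 p q = (sigma (det2 q) * Num.sqrt `|det2 q|)%:E) /\
    (forall q : poly2 R, q \in Hdeg 3 ->
       shapeK 3 p q = (sigmastar (disc3 q) * (`|disc3 q| `^ (4^-1)))%:E).
Proof.
(* Dependence on the sign alone is built in through [Num.sg]; [fine] loses nothing because the
   values are finite. *)
exists (fun t => fine (shape_of 2 p (form2 1 0 (Num.sg t)))).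
(* The factor 4^(-1/4) absorbs the discriminant of absolute value 4 of the nondegenerate cubic
   normal forms. *)
exists (fun t => fine (shape_of 3 p (form3 1 0 (- Num.sg t) 0)) * 4^-1 `^ 4^-1).
split=> [t|]; first by rewrite fine_ge0 // shape_of_ge0.
split=> [t|]; first by rewrite mulr_ge0 ?powR_ge0 // fine_ge0 // shape_of_ge0.
split=> [s t ->//|]; split=> [s t ->//|]; split=> q hq.
  rewrite /shapeK (_ : eval2 q = form2 (coef2 2 0 q) (coef2 1 1 q) (coef2 0 2 q)).
    by rewrite -/(shape_of _ _ _) K2E // EFinM fineK // K2_fin.
  by apply/funext => z; rewrite Hdeg2E.
rewrite /shapeK (_ : eval2 q =
    form3 (coef2 3 0 q) (coef2 2 1 q) (coef2 1 2 q) (coef2 0 3 q)).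
  rewrite -/(shape_of _ _ _) K3E // -/(disc3 q) -mulrA EFinM fineK ?K3_fin //.
  by congr (_ * _%:E)%E; rewrite powRM // mulrC.
by apply/funext => z; rewrite Hdeg3E.
Qed.
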